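(* Let $d>0$ satisfy $$\cosh\!\left(\frac1{2d}\right)\ge(1+2\sqrt2)\cosh\!\left(\frac1{6d}\right)$$ (numerically, $d\le 0.2181$ approximately). Then, in the limit $n\to\infty$ (that is, for all sufficiently large $n$ divisible by $3$), the discrete system $$u_t=-u+\frac{u^2}{v},\qquad 0=d^2n^2\,\mathcal L v-v+u^2$$ on the cycle with $n$ nodes has an unstable, evenly distributed, asymmetric three-spike solution.
   Context: The nodes of the cycle graph with $n$ nodes are identified with the points $x=j/n$, $j\in\mathbb Z/n\mathbb Z$, of the circle $\mathbb R/\mathbb Z$, and $(\mathcal L v)(x)=v(x+\tfrac1n)+v(x-\tfrac1n)-2v(x)$. The parameter $d$ does not depend on $n$. An evenly distributed three-spike solution is a steady state with $v>0$, $u(x_k)=v(x_k)>0$ at the three points $x_k=k/3$, $k=1,2,3$, and $u=0$ at all other nodes, with $u(x_k)\sim nV_k$ as $n\to\infty$ for constants $V_k>0$ independent of $n$. It is asymmetric if $V_1,V_2,V_3$ are not all equal. A steady state $(u_s,v_s)$ is unstable if the linearized problem $$\lambda\phi=-\phi+\frac{2u_s}{v_s}\phi-\frac{u_s^2}{v_s^2}\psi,\qquad 0=d^2n^2\mathcal L\psi-\psi+2u_s\phi$$ has a solution $(\phi,\psi)\neq(0,0)$ for some $\lambda$ with $\operatorname{Re}\lambda>0$.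
   Formalization: When the inequality for d is an equality no exact asymmetric three-spike steady state exists for any n; there the theorem asserts only a steady state to leading order (v-equation exact, u/v→1 at spikes) with unstable linearization; for strict inequality the solutions are exact. *)

(* Defs.v *)
From mathcomp Require Import all_boot all_order all_algebra.
From mathcomp Require Import complex.
From mathcomp Require Import all_classical all_reals all_analysis.

Set Implicit Arguments.
Unset Strict Implicit.
Unset Printing Implicit Defensive.

Import Order.TTheory GRing.Theory Num.Theory.
Import numFieldNormedType.Exports.

Local Open Scope ring_scope.
Local Open Scope complex_scope.
Local Open Scope classical_set_scope.

Definition cosh (R : realType) (x : R) : R := (expR x + expR (- x)) / 2.

(* Node j : 'I_n is the point j/n of the circle R/Z; ordS and ord_pred are the
   successor and the predecessor modulo n.  The codomain is left general because
   the operator acts on real states and on complex perturbations. *)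
Definition cycle_laplacian (K : pzRingType) (n : nat) (w : 'I_n -> K)
    (j : 'I_n) : K :=
  w (ordS j) + w (ord_pred j) - 2 * w j.

Definition v_equation (R : realType) (d : R) (n : nat) (u v : 'I_n -> R) :
    Prop :=
  forall j, 0 = d ^+ 2 * n%:R ^+ 2 * cycle_laplacian v j - v j + u j ^+ 2.

Definition steady_state (R : realType) (d : R) (n : nat) (u v : 'I_n -> R) :
    Prop :=
  (forall j, 0 = - u j + u j ^+ 2 / v j) /\ v_equation d u v.

Definition unstable (R : realType) (d : R) (n : nat) (u v : 'I_n -> R) : Prop :=
  exists (lambda : R[i]) (phi psi : 'I_n -> R[i]),
  [/\ 0 < complex.Re lambda,
      exists j, phi j != 0 \/ psi j != 0,
      forall j, lambda * phi j =
        - phi j + (2 * u j / v j)%:C * phi j - (u j ^+ 2 / v j ^+ 2)%:C * psi j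
    & forall j, 0 =
        (d ^+ 2 * n%:R ^+ 2)%:C * cycle_laplacian psi j - psi j
        + (2 * u j)%:C * phi j].

Lemma spike_node_subproof (m : nat) (k : 'I_3) : (k * m.+1 < 3 * m.+1)%N.
Proof. by rewrite ltn_mul2r /= ltn_ord. Qed.

(* On the cycle with n = 3 * m.+1 nodes (every positive multiple of 3 has this
   form) the node k * m.+1 is the point k/3.  The index k runs over 0, 1, 2
   since 3/3 and 0 are the same point of R/Z. *)
Definition spike_node (m : nat) (k : 'I_3) : 'I_(3 * m.+1) :=
  Ordinal (spike_node_subproof m k).

Definition spike_shape (R : realType) (m : nat) (u v : 'I_(3 * m.+1) -> R) :
    Prop :=
  [/\ forall j, 0 < v j,
      forall k, 0 < u (spike_node m k)
    & forall j, (forall k, j != spike_node m k) -> u j = 0].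

Definition three_spike_solution (R : realType) (d : R) (m : nat)
    (u v : 'I_(3 * m.+1) -> R) : Prop :=
  [/\ spike_shape u v,
      forall k, u (spike_node m k) = v (spike_node m k)
    & steady_state d u v].

(* Steady states to leading order as m --> oo: the equation of v and the
   equation of u away from the spikes hold exactly, and the condition u = v,
   which is the equation of u at a spike, is relaxed to u / v --> 1.  This is
   the sense left for the critical d, where
   cosh (1/(2d)) = (1 + 2 sqrt 2) cosh (1/(6d)).  With n nodes the ratio of the
   Green function of the v-equation at distances 0 and 1/3 is
   cosh (s/2) / cosh (s/6), where s = 2 n arsinh (1/(2dn)) < 1/d.  Asymmetric
   exact solutions require this ratio to be at least 1 + 2 sqrt 2, so at the
   critical d there is none for any n. *)
Definition three_spike_in_the_limit (R : realType) (d : R)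
    (u v : forall m, 'I_(3 * m.+1) -> R) : Prop :=
  (\forall m \near \oo, spike_shape (u m) (v m) /\ v_equation d (u m) (v m)) /\
  (forall k, u m (spike_node m k) / v m (spike_node m k) @[m --> \oo] --> (1 : R)).

(* Main.v *)
Require Import Defs.
From mathcomp Require Import all_boot all_order all_algebra.
From mathcomp Require Import complex.
From mathcomp Require Import all_classical all_reals all_analysis.
From mathcomp Require Import ring lra.
Import Order.TTheory GRing.Theory Num.Theory.
Import numFieldNormedType.Exports.
Local Open Scope ring_scope.
Local Open Scope classical_set_scope.

(** The solution and its unstable mode are explicit.

    Put [n = 3 * m.+1] and let [theta > 0] satisfy
    [sinh (theta / 2) = 1 / (2 d n)]; then [s = n theta] tends to [1 / d]
    ([cvg_total_rate]).  The Green function of [1 - d^2 n^2 L] on the cycle is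
    a multiple of [cosh (theta e - s / 2)], where [e] is the number of steps
    from the source ([green_equation]).  Among the three spike nodes it takes
    two values, proportional to [cosh (s / 2)] on the diagonal and to
    [cosh (s / 6)] off it.  Let [g] be their difference and
    [r = cosh (s / 6) / (cosh (s / 2) - cosh (s / 6))] the off-diagonal value
    divided by [g].  With [U_k = P_k / g], the condition [u = v] at the spikes
    reads [P_k = P_k^2 + r (P_0^2 + P_1^2 + P_2^2)].  So all [P_k] are roots of
    one quadratic polynomial whose roots sum to [1].  The choice
    [P = (1, t, t) / (1 + t)] solves the system if and only if
    [r (1 + 2 t^2) = t], and this has the real root
    [t = (1 - sqrt (1 - 8 r^2)) / (4 r)], which lies in [(0, 1)], as soon as
    [8 r^2 <= 1] ([small_ratio_root], [small_ratio_lt1]).  In the limit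
    [s = 1 / d] this inequality is the hypothesis on [d], and the strict
    inequalities correspond too ([coupling_at_threshold]).

    Since [sqrt] vanishes on negative numbers, the same formulas define [u] and
    [v] for every [n].  They solve the [v]-equation exactly, and
    [u / v] at the spikes is a continuous function of [r], equal to [1] at the
    limit of [r].  If the hypothesis is strict then [8 r^2 <= 1] for all large
    [n], and the solution is exact ([spike_solution]).

    For instability, take [phi] equal to [1] and [-1] at the two small spikes
    and [0] elsewhere.  By symmetry it is an eigenvector.  Its eigenvalue is a
    continuous function of [r] ([contrast_rate]), and at the limit of [r] it is
    [1 - 2 t / (1 + t) = (1 - t) / (1 + t) > 0]. *)

Set Implicit Arguments.
Unset Strict Implicit.
Unset Printing Implicit Defensive.

(** * Hyperbolic functions *)

Definition sinh (R : realType) (x : R) : R := (expR x - expR (- x)) / 2.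

Lemma coshN (R : realType) (x : R) : cosh (- x) = cosh x.
Proof. by rewrite /cosh opprK addrC. Qed.

Lemma coshD_addB (R : realType) (x y : R) :
  cosh (x + y) + cosh (x - y) = 2 * cosh x * cosh y.
Proof. by rewrite /cosh !opprD !opprK !expRD; field. Qed.

Lemma coshD_subB (R : realType) (x y : R) :
  cosh (x + y) - cosh (x - y) = 2 * sinh x * sinh y.
Proof. by rewrite /cosh /sinh !opprD !opprK !expRD; field. Qed.

Lemma cosh_double (R : realType) (x : R) : cosh (2 * x) = 1 + 2 * sinh x ^+ 2.
Proof.
have e := expRxMexpNx_1 x.
rewrite mulr_natl mulr2n /cosh /sinh opprD !expRD; lra.
Qed.

Lemma sinh_double (R : realType) (x : R) :
  sinh (2 * x) = 2 * sinh x * cosh x.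
Proof.
by rewrite mulr_natl mulr2n /cosh /sinh opprD !expRD; field.
Qed.

Lemma sinh_gt0 (R : realType) (x : R) : 0 < x -> 0 < sinh x.
Proof. by move=> x0; rewrite divr_gt0// subr_gt0 ltr_expR gtrN. Qed.

Lemma cosh_gt0 (R : realType) (x : R) : 0 < cosh x.
Proof. by rewrite divr_gt0// addr_gt0// expR_gt0. Qed.

Lemma cosh_lt (R : realType) (x y : R) : 0 <= x -> x < y -> cosh x < cosh y.
Proof.
move=> x0 xy.
have : 0 < 2 * sinh ((y + x) / 2) * sinh ((y - x) / 2).
  by apply: mulr_gt0; [apply: mulr_gt0 => //|]; apply: sinh_gt0; lra.
rewrite -coshD_subB subr_gt0.
by congr (cosh _ < cosh _); field.
Qed.

Lemma continuous_cosh (R : realType) : continuous (@cosh R).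
Proof.
move=> x; apply: cvgM; last exact: cvg_cst.
apply: cvgD; first exact: continuous_expR.
by apply: (@continuous_comp _ _ _ -%R);
  [exact: opp_continuous|exact: continuous_expR].
Qed.

Lemma continuous_sinh (R : realType) : continuous (@sinh R).
Proof.
move=> x; apply: cvgM; last exact: cvg_cst.
apply: cvgB; first exact: continuous_expR.
by apply: (@continuous_comp _ _ _ -%R);
  [exact: opp_continuous|exact: continuous_expR].
Qed.

(** The inverse function of [sinh]; see [sinh_arsinh]. *)
Definition arsinh (R : realType) (y : R) : R := ln (y + Num.sqrt (1 + y ^+ 2)).

Lemma expR_arsinh (R : realType) (y : R) :
  expR (arsinh y) = y + Num.sqrt (1 + y ^+ 2).
Proof.
have y1 : 0 < 1 + y ^+ 2 by have := sqr_ge0 y; lra.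
rewrite lnK// posrE.
have : `|y| < Num.sqrt (1 + y ^+ 2) by rewrite -sqrtr_sqr ltr_sqrt//; lra.
by rewrite ltr_norml => /andP[+ _]; lra.
Qed.

Lemma expRN_arsinh (R : realType) (y : R) :
  expR (- arsinh y) = Num.sqrt (1 + y ^+ 2) - y.
Proof.
have y1 : 0 <= 1 + y ^+ 2 by have := sqr_ge0 y; lra.
apply: (mulfI (lt0r_neq0 (expR_gt0 (arsinh y)))).
rewrite expRxMexpNx_1 expR_arsinh.
have := sqr_sqrtr y1; move: (Num.sqrt _) => c; lra.
Qed.

Lemma sinh_arsinh (R : realType) (y : R) : sinh (arsinh y) = y.
Proof. by rewrite /sinh expRN_arsinh expR_arsinh; field. Qed.

Lemma cosh_arsinh (R : realType) (y : R) :
  cosh (arsinh y) = Num.sqrt (1 + y ^+ 2).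
Proof. by rewrite /cosh expRN_arsinh expR_arsinh; field. Qed.

(** Both bounds follow from [1 + x <= expR x], at [x = - arsinh y] and at
    [x = arsinh y]; they give [arsinh y / y --> 1] as [y] decreases to [0]. *)
Lemma arsinh_bounds (R : realType) (y : R) : 0 < y ->
  y / (1 + y) <= arsinh y <= y + y ^+ 2 / 2.
Proof.
move=> y0; have y1 : 0 < 1 + y ^+ 2 by have := sqr_ge0 y; lra.
have c1 : 1 <= Num.sqrt (1 + y ^+ 2).
  by rewrite -[leLHS]sqrtr1 ler_sqrt//; have := sqr_ge0 y; lra.
have := expRN_arsinh y; have := expR_arsinh y; have := sqr_sqrtr (ltW y1).
move: (Num.sqrt _) c1 => c c1 cc ep en; apply/andP; split.
  have := expR_ge1Dx (- arsinh y); rewrite en => h.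
  have -> : y / (1 + y) = 1 - (1 + y)^-1 by field; lra.
  suff : c - y <= (1 + y)^-1 by lra.
  by rewrite -[leRHS]mul1r ler_pdivlMr; nra.
by have := expR_ge1Dx (arsinh y); rewrite ep; nra.
Qed.

Lemma arsinh_gt0 (R : realType) (y : R) : 0 < y -> 0 < arsinh y.
Proof.
move=> y0; have /andP[+ _] := arsinh_bounds y0; apply: lt_le_trans.
by rewrite divr_gt0//; lra.
Qed.

(** * The Green function of the cycle *)

(** The number [theta] for which [cosh (theta x)] is an eigenfunction of
    [d^2 n^2 L] with eigenvalue [1]; see [cosh_mesh_rate]. *)
Definition mesh_rate (R : realType) (d : R) (n : nat) : R :=
  2 * arsinh (1 / (2 * d * n%:R)).

(** The rate [mesh_rate] accumulated over one turn of the cycle. *)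
Definition total_rate (R : realType) (d : R) (n : nat) : R :=
  n%:R * mesh_rate d n.

(** The factor that normalizes the jump of [green] at its source. *)
Definition green_norm (R : realType) (d : R) (n : nat) : R :=
  2 * d ^+ 2 * n%:R ^+ 2 * sinh (mesh_rate d n) * sinh (total_rate d n / 2).

(** The Green function of [1 - d^2 n^2 L] with source [k], evaluated at [j];
    [(j + (n - k)) %% n] is the number of forward steps from [k] to [j]. *)
Definition green (R : realType) (d : R) (n : nat) (k j : 'I_n) : R :=
  cosh (mesh_rate d n * ((j + (n - k)) %% n)%:R - total_rate d n / 2)
  / green_norm d n.

Lemma mesh_rate_gt0 (R : realType) (d : R) (n : nat)
    (d0 : 0 < d) (n0 : (0 < n)%N) : 0 < mesh_rate d n.
Proof.
by rewrite mulr_gt0// arsinh_gt0// divr_gt0// !mulr_gt0// ltr0n.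
Qed.

Lemma total_rate_gt0 (R : realType) (d : R) (n : nat)
    (d0 : 0 < d) (n0 : (0 < n)%N) : 0 < total_rate d n.
Proof. by rewrite mulr_gt0 ?ltr0n// (mesh_rate_gt0 d0 n0). Qed.

Lemma green_norm_gt0 (R : realType) (d : R) (n : nat)
    (d0 : 0 < d) (n0 : (0 < n)%N) : 0 < green_norm d n.
Proof.
have nR : 0 < n%:R :> R by rewrite ltr0n.
have s0 : 0 < sinh (total_rate d n / 2).
  by rewrite sinh_gt0// divr_gt0// (total_rate_gt0 d0 n0).
have r0 : 0 < sinh (mesh_rate d n) by rewrite sinh_gt0// (mesh_rate_gt0 d0 n0).
by apply: mulr_gt0 => //; apply: mulr_gt0 => //; rewrite !mulr_gt0.
Qed.

Lemma green_gt0 (R : realType) (d : R) (n : nat)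
    (d0 : 0 < d) (n0 : (0 < n)%N) (k j : 'I_n) : 0 < green d k j.
Proof. by rewrite divr_gt0 ?cosh_gt0 ?(green_norm_gt0 d0 n0). Qed.

Lemma cosh_mesh_rate (R : realType) (d : R) (n : nat)
    (d0 : 0 < d) (n0 : (0 < n)%N) :
  d ^+ 2 * n%:R ^+ 2 * (2 * cosh (mesh_rate d n) - 2) = 1.
Proof.
rewrite cosh_double sinh_arsinh; field.
by rewrite pnatr_eq0 -lt0n n0 gt_eqF.
Qed.

Lemma sinh_mesh_rate (R : realType) (d : R) (n : nat)
    (d0 : 0 < d) (n0 : (0 < n)%N) :
  sinh (mesh_rate d n) =
  Num.sqrt (1 + (1 / (2 * d * n%:R)) ^+ 2) / (d * n%:R).
Proof.
rewrite sinh_double sinh_arsinh cosh_arsinh; field.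
by rewrite pnatr_eq0 -lt0n n0 gt_eqF.
Qed.

Lemma green_equation (R : realType) (d : R) (n : nat)
    (d0 : 0 < d) (n0 : (0 < n)%N) (k j : 'I_n) :
  d ^+ 2 * n%:R ^+ 2 * cycle_laplacian (green d k) j - green d k j =
  - (j == k)%:R.
Proof.
pose F (x : R) := cosh (mesh_rate d n * x - total_rate d n / 2).
have Fn : F n%:R = F 0.
  rewrite /F mulr0 add0r coshN /total_rate.
  by congr cosh; field.
(* A forward step always turns [F e] into [F (e + 1)], because of the
   periodicity [Fn].  A backward step turns it into [F (e - 1)], except at
   the source [e = 0], where it gives [F (n - 1)]: this is the jump. *)
set e := ((j + (n - k)) %% n)%N.
have en : (e < n)%N by rewrite ltn_mod.
have gE : green d k j = F e%:R / green_norm d n by [].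
have gS : green d k (ordS j) = F (e%:R + 1) / green_norm d n.
  rewrite /green /= modnDml addSn -addn1 -modnDml -/e.
  congr (_ / _); rewrite natr1 addn1.
  case: (ltngtP e.+1 n) en => [l _|//|-> _]; first by rewrite modn_small.
  by rewrite modnn [RHS]Fn.
have eE : (e == 0)%N = (j == k).
  rewrite /e; apply/idP/eqP => [|->]; last first.
    by rewrite subnKC ?modnn// ltnW.
  have [jk|kj] := ltnP j k.
    rewrite modn_small; last first.
      by rewrite addnBA ?(ltnW (ltn_ord k))// ltn_subLR ?ltn_add2r//
        (leq_trans (ltnW (ltn_ord k))) ?leq_addl.
    by rewrite addn_eq0 subn_eq0 leqNgt ltn_ord andbF.
  rewrite addnBCA ?(ltnW (ltn_ord k))// modnDl modn_small; last first.
    by rewrite (leq_ltn_trans (leq_subr _ _)).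
  by rewrite subn_eq0 => jk; apply/val_inj/eqP; rewrite eqn_leq jk kj.
have gP : green d k (ord_pred j) =
    (F (e%:R - 1) - (j == k)%:R * (F (- 1) - F (n%:R - 1))) / green_norm d n.
  rewrite /green /= modnDml.
  have -> : ((j + n).-1 + (n - k) = j + (n - k) + n.-1)%N.
    by rewrite -subn1 -addnBA// subn1 -!addnA [(n.-1 + _)%N]addnC.
  rewrite -modnDml -/e -eE; congr (_ / _).
  have [->|e0] := eqVneq e 0%N.
    rewrite add0n modn_small ?prednK// mul1r sub0r subKr /F.
    by rewrite -subn1 natrB.
  rewrite mul0r subr0 -subn1 addnBA// -addnBAC ?lt0n// modnDr modn_small.
    by rewrite natrB ?lt0n.
  by rewrite (leq_ltn_trans (leq_subr _ _)).
rewrite /cycle_laplacian gE gS gP.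
have F1 : F (e%:R + 1) + F (e%:R - 1) = 2 * cosh (mesh_rate d n) * F e%:R.
  by rewrite mulrAC -coshD_addB /F; congr (cosh _ + cosh _); ring.
have F2 : F (- 1) - F (n%:R - 1) =
    2 * sinh (total_rate d n / 2) * sinh (mesh_rate d n).
  rewrite -coshD_subB /F; congr (_ - _); last first.
    by congr cosh; rewrite /total_rate; field.
  by rewrite -coshN; congr cosh; rewrite /total_rate; field.
have NE : green_norm d n = d ^+ 2 * n%:R ^+ 2 * (F (- 1) - F (n%:R - 1)).
  by rewrite F2 /green_norm; ring.
have N0 := lt0r_neq0 (green_norm_gt0 d0 n0).
apply: (mulIf N0).
transitivity (d ^+ 2 * n%:R ^+ 2 * (F (e%:R + 1) + F (e%:R - 1) - 2 * F e%:R) -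
  F e%:R - (j == k)%:R * (d ^+ 2 * n%:R ^+ 2 * (F (- 1) - F (n%:R - 1)))).
  by field.
transitivity ((d ^+ 2 * n%:R ^+ 2 * (2 * cosh (mesh_rate d n) - 2) - 1) *
  F e%:R - (j == k)%:R * green_norm d n); first by rewrite -NE F1; ring.
by rewrite (cosh_mesh_rate d0 n0); ring.
Qed.

(** * The spike amplitudes as functions of the coupling *)

(** The ratio of a small spike to the large one: the smaller root [t] of
    [2 r t^2 - t + r = 0] if [8 r^2 <= 1].  For larger [r] the square root
    is [0] and the value is [1 / (4 r)]. *)
Definition small_ratio (R : realType) (r : R) : R :=
  (1 - Num.sqrt (1 - 8 * r ^+ 2)) / (4 * r).

Lemma small_ratio_gt0 (R : realType) (r : R) : 0 < r -> 0 < small_ratio r.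
Proof.
move=> r0; rewrite divr_gt0 ?mulr_gt0// subr_gt0.
by rewrite -[ltRHS]sqrtr1 ltr_sqrt//; nra.
Qed.

Lemma small_ratio_root (R : realType) (r : R) : 0 < r -> 8 * r ^+ 2 <= 1 ->
  r * (1 + 2 * small_ratio r ^+ 2) = small_ratio r.
Proof.
move=> r0 r1; rewrite /small_ratio.
have r2 : 0 <= 1 - 8 * r ^+ 2 by lra.
have := sqr_sqrtr r2.
move: (Num.sqrt _) => q qq.
transitivity ((8 * r ^+ 2 + 1 - 2 * q + q ^+ 2) / (8 * r)); first by field; lra.
by rewrite qq; field; lra.
Qed.

Lemma small_ratio_lt1 (R : realType) (r : R) : 0 < r -> 8 * r ^+ 2 <= 1 ->
  small_ratio r < 1.
Proof.
move=> r0 r1; rewrite ltr_pdivrMr; last by lra.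
have r2 : 0 <= 1 - 8 * r ^+ 2 by lra.
have := sqr_sqrtr r2.
have := sqrtr_ge0 (1 - 8 * r ^+ 2).
move: (Num.sqrt _) => q q0 qq.
rewrite mul1r ltrBlDr.
have [|] := lerP 1 (4 * r); first by nra.
nra.
Qed.

(** Normalized amplitudes: spike [0] is large, the two others are small and
    equal. *)
Definition profile (R : realType) (r : R) (k : 'I_3) : R :=
  (if k == ord0 then 1 else small_ratio r) / (1 + small_ratio r).

(** The value at spike [k], in the same normalization, of the solution of the
    [v]-equation driven by the squared amplitudes [profile r]. *)
Definition response (R : realType) (r : R) (k : 'I_3) : R :=
  profile r k ^+ 2 + r * \sum_l profile r l ^+ 2.

Lemma profile_gt0 (R : realType) (r : R) k : 0 < r -> 0 < profile r k.
Proof.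
by move=> /small_ratio_gt0 t0; rewrite divr_gt0//; [case: ifP|lra].
Qed.

Lemma response_gt0 (R : realType) (r : R) k : 0 < r -> 0 < response r k.
Proof.
move=> r0; rewrite ltr_pwDl ?exprn_gt0 ?profile_gt0// mulr_ge0 ?(ltW r0)//.
by rewrite sumr_ge0// => l _; rewrite sqr_ge0.
Qed.

(** The spikes are consistent, [u = v], when the quadratic equation for
    [small_ratio] has a real root. *)
Lemma response_profile (R : realType) (r : R) k : 0 < r -> 8 * r ^+ 2 <= 1 ->
  response r k = profile r k.
Proof.
move=> r0 r1; have t0 := small_ratio_gt0 r0; have := small_ratio_root r0 r1.
rewrite /response !big_ord_recl big_ord0 /profile /=.
move: (small_ratio r) t0 => t t0 e.
transitivity (((if k == ord0 then 1 else t) ^+ 2 + r * (1 + 2 * t ^+ 2))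
   / (1 + t) ^+ 2); first by case: ifP => _; field; lra.
by rewrite e; case: ifP => _; field; lra.
Qed.

Lemma small_ratio_continuous (R : realType) (r : R) : 0 < r ->
  {for r, continuous (@small_ratio R)}.
Proof.
move=> r0; apply: cvgM.
  apply: cvgB; first exact: cvg_cst.
  apply: (@continuous_comp _ _ _ (fun x : R => 1 - 8 * x ^+ 2)); last first.
    exact: sqrt_continuous.
  apply: cvgB; first exact: cvg_cst.
  by apply: cvgM; [exact: cvg_cst|exact: exprn_continuous].
apply: cvgV; first by rewrite gt_eqF// mulr_gt0.
by apply: cvgM; [exact: cvg_cst|exact: cvg_id].
Qed.

Lemma profile_continuous (R : realType) (r : R) k : 0 < r ->
  {for r, continuous (fun x : R => profile x k)}.
Proof.
move=> r0; have c := small_ratio_continuous r0.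
apply: cvgM; first by case: ifP => _; [exact: cvg_cst|exact: c].
apply: cvgV; first by have := small_ratio_gt0 r0; lra.
by apply: cvgD; [exact: cvg_cst|exact: c].
Qed.

Lemma response_continuous (R : realType) (r : R) k : 0 < r ->
  {for r, continuous (fun x : R => response x k)}.
Proof.
move=> r0; have c l := @profile_continuous R r l r0.
have c2 l : profile x l ^+ 2 @[x --> r] --> profile r l ^+ 2.
  by apply: (continuous_cvg _ (h := fun y : R => y ^+ 2));
    [exact: exprn_continuous|exact: c].
apply: cvgD; first exact: c2.
apply: cvgM; first exact: cvg_id.
by apply: cvg_big => [|l _]; [exact: add_continuous|exact: c2].
Qed.

(** * The three-spike solution *)

(** The difference of the values of [green] at its source and at the two other
    spike nodes. *)
Definition self_gap (R : realType) (d : R) (n : nat) : R :=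
  (cosh (total_rate d n / 2) - cosh (total_rate d n / 6)) / green_norm d n.

(** The value of [green] from one spike node to another, divided by
    [self_gap], as a function of the total rate [s]. *)
Definition coupling_at (R : realType) (s : R) : R :=
  cosh (s / 6) / (cosh (s / 2) - cosh (s / 6)).

Definition coupling (R : realType) (d : R) (n : nat) : R :=
  coupling_at (total_rate d n).

Lemma cosh_third_lt (R : realType) (s : R) : 0 < s ->
  cosh (s / 6) < cosh (s / 2).
Proof. by move=> s0; rewrite cosh_lt//; lra. Qed.

Lemma coupling_at_gt0 (R : realType) (s : R) : 0 < s -> 0 < coupling_at s.
Proof.
by move=> s0; rewrite divr_gt0 ?cosh_gt0// subr_gt0 cosh_third_lt.
Qed.

Lemma coupling_gt0 (R : realType) (d : R) (n : nat)
    (d0 : 0 < d) (n0 : (0 < n)%N) : 0 < coupling d n.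
Proof. by rewrite coupling_at_gt0// (total_rate_gt0 d0 n0). Qed.

Lemma self_gap_gt0 (R : realType) (d : R) (n : nat)
    (d0 : 0 < d) (n0 : (0 < n)%N) : 0 < self_gap d n.
Proof.
rewrite divr_gt0 ?(green_norm_gt0 d0 n0)// subr_gt0.
by rewrite cosh_third_lt// (total_rate_gt0 d0 n0).
Qed.

Lemma spike_node_inj (m : nat) : injective (spike_node m).
Proof.
by move=> k l /(congr1 val)/= /eqP; rewrite eqn_pmul2r// => /eqP/val_inj.
Qed.

Lemma green_spike_node (R : realType) (d : R) (d0 : 0 < d) (m : nat)
    (k l : 'I_3) :
  green d (spike_node m k) (spike_node m l) =
  self_gap d (3 * m.+1) * ((l == k)%:R + coupling d (3 * m.+1)).
Proof.
have n0 : (0 < 3 * m.+1)%N by [].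
have g0 := lt0r_neq0 (green_norm_gt0 d0 n0).
have := cosh_third_lt (total_rate_gt0 d0 n0).
rewrite -subr_gt0 => /lt0r_neq0 c0.
rewrite /green /self_gap /coupling /coupling_at /=.
have -> : ((l * m.+1 + (3 * m.+1 - k * m.+1)) %% (3 * m.+1) =
    ((l + (3 - k)) %% 3) * m.+1)%N.
  by rewrite -mulnBl -mulnDl -muln_modl.
set s := total_rate d _; set e := ((l + (3 - k)) %% 3)%N.
have -> : mesh_rate d (3 * m.+1) * (e * m.+1)%:R - s / 2 =
    s * (e%:R / 3 - 1 / 2).
  by rewrite /s /total_rate !natrM; field.
have [lk|lk] := eqVneq l k.
  have -> : e = 0%N by rewrite /e lk subnKC ?modnn// ltnW.
  have -> : s * (0%:R / 3 - 1 / 2) = - (s / 2) by field.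
  rewrite coshN /=.
  by field; rewrite g0 c0.
have -> : cosh (s * (e%:R / 3 - 1 / 2)) = cosh (s / 6).
  have : e = 1%N \/ e = 2%N.
    rewrite /e; clear -lk;
    case: k l lk => [[|[|[|//]]] ?] [[|[|[|//]]] ?] //= _;
      by [left|right].
  case=> ->; last by congr cosh; field.
  by rewrite -coshN; congr cosh; field.
by rewrite /=; field; rewrite g0 c0.
Qed.

(** The value of [u] at spike [k]. *)
Definition height (R : realType) (d : R) (m : nat) (k : 'I_3) : R :=
  profile (coupling d (3 * m.+1)) k / self_gap d (3 * m.+1).

(** The state [u], supported on the spike nodes. *)
Definition spike_u (R : realType) (d : R) (m : nat) (j : 'I_(3 * m.+1)) : R :=
  \sum_k (j == spike_node m k)%:R * height d m k.

(** The state [v], the exact solution of the [v]-equation for [spike_u]. *)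
Definition spike_v (R : realType) (d : R) (m : nat) (j : 'I_(3 * m.+1)) : R :=
  \sum_k height d m k ^+ 2 * green d (spike_node m k) j.

Lemma sum_spike_node (R : realType) (m : nat) (c : 'I_3 -> R) (k : 'I_3) :
  \sum_l (spike_node m k == spike_node m l)%:R * c l = c k.
Proof.
rewrite (bigD1 k)//= eqxx mul1r big1 ?addr0// => l lk.
by rewrite (inj_eq (@spike_node_inj m)) eq_sym (negPf lk) mul0r.
Qed.

Lemma sum_off_spike (R : realType) (m : nat) (c : 'I_3 -> R) j :
  (forall k, j != spike_node m k) ->
  \sum_l (j == spike_node m l)%:R * c l = 0.
Proof. by move=> jk; rewrite big1// => l _; rewrite (negPf (jk l)) mul0r. Qed.

Lemma spike_nodeP (m : nat) (P : 'I_(3 * m.+1) -> Prop) :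
  (forall k, P (spike_node m k)) ->
  (forall j, (forall k, j != spike_node m k) -> P j) -> forall j, P j.
Proof.
move=> Ps Po j; have [/existsP[k /eqP->]//|/existsPn h] :=
  boolP [exists k, j == spike_node m k].
exact: Po.
Qed.

Lemma height_gt0 (R : realType) (d : R) (d0 : 0 < d) (m : nat) k :
  0 < height d m k.
Proof. by rewrite divr_gt0 ?self_gap_gt0// profile_gt0// coupling_gt0. Qed.

Lemma spike_v_node (R : realType) (d : R) (d0 : 0 < d) (m : nat) k :
  spike_v d (spike_node m k) =
  response (coupling d (3 * m.+1)) k / self_gap d (3 * m.+1).
Proof.
have g0 := lt0r_neq0 (self_gap_gt0 d0 (isT : 0 < 3 * m.+1)%N).
rewrite /spike_v /response.
rewrite -(sum_spike_node m (fun l => profile (coupling d (3 * m.+1)) l ^+ 2)).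
rewrite mulr_sumr -big_split mulr_suml; apply: eq_bigr => l _ /=.
rewrite green_spike_node// (inj_eq (@spike_node_inj m)) /height.
by field.
Qed.

Lemma cycle_laplacian_sum (R : realType) (n : nat) (c : 'I_3 -> R)
    (w : 'I_3 -> 'I_n -> R) j :
  cycle_laplacian (fun i => \sum_k c k * w k i) j =
  \sum_k c k * cycle_laplacian (w k) j.
Proof.
rewrite /cycle_laplacian mulr_sumr -sumrN -!big_split.
by apply: eq_bigr => k _ /=; ring.
Qed.

Lemma spike_v_equation (R : realType) (d : R) (d0 : 0 < d) (m : nat) :
  v_equation d (@spike_u R d m) (@spike_v R d m).
Proof.
have n0 : (0 < 3 * m.+1)%N by [].
move=> j; rewrite cycle_laplacian_sum.
have -> : spike_u d j ^+ 2 =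
    \sum_k (j == spike_node m k)%:R * height d m k ^+ 2.
  move: j; apply: spike_nodeP => [k|j jk].
    by rewrite /spike_u !sum_spike_node.
  by rewrite /spike_u !sum_off_spike// expr0n.
rewrite mulr_sumr -sumrN -!big_split big1//= => k _.
transitivity (height d m k ^+ 2 * (d ^+ 2 * (3 * m.+1)%:R ^+ 2 *
  cycle_laplacian (green d (spike_node m k)) j - green d (spike_node m k) j +
  (j == spike_node m k)%:R)); first by ring.
by rewrite green_equation// addNr mulr0.
Qed.

Lemma spike_shape_spike (R : realType) (d : R) (d0 : 0 < d) (m : nat) :
  spike_shape (@spike_u R d m) (@spike_v R d m).
Proof.
split=> [j|k|j jk]; last by rewrite /spike_u sum_off_spike.
  rewrite /spike_v big_ord_recl ltr_pwDl//.
    by rewrite mulr_gt0 ?green_gt0// exprn_gt0// height_gt0.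
  by rewrite sumr_ge0// => k _; rewrite mulr_ge0 ?sqr_ge0// ltW// green_gt0.
by rewrite /spike_u sum_spike_node height_gt0.
Qed.

Lemma spike_solution (R : realType) (d : R) (d0 : 0 < d) (m : nat) :
  8 * coupling d (3 * m.+1) ^+ 2 <= 1 ->
  three_spike_solution d (@spike_u R d m) (@spike_v R d m).
Proof.
move=> r8; have uv k : spike_u d (spike_node m k) = spike_v d (spike_node m k).
  rewrite spike_v_node// response_profile ?coupling_gt0//.
  by rewrite /spike_u sum_spike_node.
have [v0 u0 off] := spike_shape_spike d0 m.
split=> //; split; last exact: spike_v_equation.
apply: spike_nodeP => [k|j jk].
  by rewrite -uv; have := u0 k; move: (spike_u _ _) => x x0; field; lra.
by rewrite off// expr0n mul0r oppr0 addr0.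
Qed.

(** * Instability *)

(** A real unstable mode gives a complex one. *)
Lemma unstable_real (R : realType) (d : R) (n : nat) (u v : 'I_n -> R)
    (lambda : R) (phi psi : 'I_n -> R) :
  0 < lambda -> (exists j, phi j != 0) ->
  (forall j, lambda * phi j =
     - phi j + 2 * u j / v j * phi j - u j ^+ 2 / v j ^+ 2 * psi j) ->
  (forall j, 0 = d ^+ 2 * n%:R ^+ 2 * cycle_laplacian psi j - psi j
     + 2 * u j * phi j) ->
  unstable d u v.
Proof.
move=> l0 [j0 nz] e1 e2.
exists lambda%:C%C, (fun j => (phi j)%:C%C), (fun j => (psi j)%:C%C).
split=> // [|j|j].
- by exists j0; left; rewrite fmorph_eq0.
- by rewrite -!rmorphM e1 !(rmorphB, rmorphD, rmorphN).
- have -> : cycle_laplacian (fun j => (psi j)%:C%C) j =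
      (cycle_laplacian psi j)%:C%C.
    by rewrite /cycle_laplacian !(rmorphB, rmorphD, rmorphM) rmorph1.
  by rewrite -!rmorphM -rmorphB -rmorphD -e2 rmorph0.
Qed.

(** The eigenvalue of the mode that is antisymmetric in the two small spikes:
    there [q = u / v], and the [psi] that this mode induces is
    [2 * profile r 1 * phi] at the spikes. *)
Definition contrast_rate (R : realType) (r : R) : R :=
  let q := profile r 1 / response r 1 in
  2 * q - 1 - 2 * q ^+ 2 * profile r 1.

Lemma spike_unstable (R : realType) (d : R) (d0 : 0 < d) (m : nat) :
  0 < contrast_rate (coupling d (3 * m.+1)) ->
  unstable d (@spike_u R d m) (@spike_v R d m).
Proof.
have n0 : (0 < 3 * m.+1)%N by [].
have k12 k : k != 0 -> height d m k = height d m 1.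
  by rewrite /height /profile => /negPf ->.
pose b (k : 'I_3) : R := (k == 1)%:R - (k == 2)%:R.
move=> l0; apply: (unstable_real (phi := fun j =>
    \sum_k (j == spike_node m k)%:R * b k)
  (psi := fun j => \sum_k (2 * height d m 1 * b k) *
     green d (spike_node m k) j) l0).
- by exists (spike_node m 1); rewrite sum_spike_node /b /= subr0 oner_neq0.
- apply: spike_nodeP => [k|j jk]; last first.
    by rewrite /spike_u !sum_off_spike//; ring.
  rewrite sum_spike_node spike_v_node// /spike_u sum_spike_node.
  have -> : \sum_l 2 * height d m 1 * b l *
      green d (spike_node m l) (spike_node m k) =
      2 * profile (coupling d (3 * m.+1)) 1 * b k.
    under eq_bigr => l _ do rewrite green_spike_node//.
    have -> : height d m 1 =
      profile (coupling d (3 * m.+1)) 1 / self_gap d (3 * m.+1) by [].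
    have := lt0r_neq0 (self_gap_gt0 d0 n0).
    set p := profile _ 1; set r := coupling _ _; set g := self_gap _ _ => g0.
    rewrite !big_ord_recl big_ord0 /b.
    by case: k => [[|[|[|//]]] ?] /=; field.
  (* The mode vanishes at the large spike; the two small spikes are alike. *)
  have [->|k0] := eqVneq k 0.
    by rewrite /b /= subrr !mulr0 oppr0 !addr0.
  have r0 := response_gt0 1 (coupling_gt0 d0 n0).
  have g0 := self_gap_gt0 d0 n0.
  have rk : response (coupling d (3 * m.+1)) k =
      response (coupling d (3 * m.+1)) 1.
    by rewrite /response /profile (negPf k0).
  rewrite k12// rk /contrast_rate /height.
  by field; rewrite !gt_eqF.
- move=> j; rewrite cycle_laplacian_sum.
  have -> : 2 * spike_u d j * \sum_k (j == spike_node m k)%:R * b k =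
      \sum_k (2 * height d m 1 * b k) * (j == spike_node m k)%:R.
    under [RHS]eq_bigr do rewrite mulrC.
    move: j; apply: spike_nodeP => [k|j jk]; last first.
      by rewrite !sum_off_spike// mulr0.
    rewrite /spike_u !sum_spike_node; have [->|k0] := eqVneq k 0.
      by rewrite /b /= subrr !mulr0.
    by rewrite k12.
  rewrite mulr_sumr -sumrN -!big_split big1//= => k _.
  transitivity (2 * height d m 1 * b k * (d ^+ 2 * (3 * m.+1)%:R ^+ 2 *
    cycle_laplacian (green d (spike_node m k)) j - green d (spike_node m k) j +
    (j == spike_node m k)%:R)); first by ring.
  by rewrite green_equation// addNr mulr0.
Qed.

(** * The limit of a large number of nodes *)

Lemma contrast_rate_gt0 (R : realType) (r : R) : 0 < r -> 8 * r ^+ 2 <= 1 ->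
  0 < contrast_rate r.
Proof.
move=> r0 r8; rewrite /contrast_rate response_profile//.
rewrite divff ?gt_eqF ?profile_gt0// /profile /=.
have t0 := small_ratio_gt0 r0; have t1 := small_ratio_lt1 r0 r8.
have -> : 2 * 1 - 1 - 2 * 1 ^+ 2 * (small_ratio r / (1 + small_ratio r)) =
  (1 - small_ratio r) / (1 + small_ratio r) by field; lra.
by rewrite divr_gt0; lra.
Qed.

Lemma contrast_rate_continuous (R : realType) (r : R) : 0 < r ->
  {for r, continuous (@contrast_rate R)}.
Proof.
move=> r0; have cp := @profile_continuous R r 1 r0.
have cq : profile x 1 / response x 1 @[x --> r] --> profile r 1 / response r 1.
  apply: cvgM; first exact: cp.
  by apply: cvgV; [rewrite gt_eqF// response_gt0|exact: response_continuous].
apply: cvgB; first apply: cvgB.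
- by apply: cvgM; [exact: cvg_cst|exact: cq].
- exact: cvg_cst.
- apply: cvgM; last exact: cp.
  apply: cvgM; first exact: cvg_cst.
  by apply: (continuous_cvg _ (h := fun y : R => y ^+ 2));
    [exact: exprn_continuous|exact: cq].
Qed.

Lemma coupling_at_continuous (R : realType) (s : R) : 0 < s ->
  {for s, continuous (@coupling_at R)}.
Proof.
move=> s0.
have cc (a : R) : cosh (x / a) @[x --> s] --> cosh (s / a).
  apply: (continuous_cvg _ (h := @cosh R)); first exact: continuous_cosh.
  by apply: cvgM; [exact: cvg_id|exact: cvg_cst].
apply: cvgM; first exact: cc.
apply: cvgV; first by rewrite gt_eqF// subr_gt0 cosh_third_lt.
by apply: cvgB; exact: cc.
Qed.

(** The condition [8 r^2 <= 1], in the limit, is the assumption on [d]: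
    compare the squares of [2 * sqrt 2 * r] and [1]. *)
Lemma coupling_at_threshold (R : realType) (d : R) (d0 : 0 < d) :
  (8 * coupling_at (1 / d) ^+ 2 <= 1) =
    ((1 + 2 * Num.sqrt 2) * cosh (1 / (6 * d)) <= cosh (1 / (2 * d))) /\
  (8 * coupling_at (1 / d) ^+ 2 < 1) =
    ((1 + 2 * Num.sqrt 2) * cosh (1 / (6 * d)) < cosh (1 / (2 * d))).
Proof.
have -> : 1 / (6 * d) = 1 / d / 6 by field; rewrite gt_eqF.
have -> : 1 / (2 * d) = 1 / d / 2 by field; rewrite gt_eqF.
have i0 : 0 < 1 / d by rewrite divr_gt0.
have D0 : 0 < cosh (1 / d / 2) - cosh (1 / d / 6).
  by rewrite subr_gt0 cosh_third_lt.
have q0 : 0 <= 2 * Num.sqrt 2 * coupling_at (1 / d).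
  apply: mulr_ge0; first by rewrite mulr_ge0 ?sqrtr_ge0.
  exact/ltW/coupling_at_gt0.
have -> : 8 * coupling_at (1 / d) ^+ 2 =
    (2 * Num.sqrt 2 * coupling_at (1 / d)) ^+ 2.
  by rewrite !exprMn sqr_sqrtr//; ring.
rewrite expr_le1// expr_lt1// /coupling_at mulrA.
set c := cosh (1 / d / 6) in D0 *; set C := cosh (1 / d / 2) in D0 *.
rewrite ler_pdivrMr// ltr_pdivrMr// mul1r lerBrDr ltrBrDr.
by rewrite [(1 + _) * _]mulrDl mul1r [_ + 2 * _ * _]addrC.
Qed.

(** The argument of [arsinh] in [mesh_rate d (3 * m.+1)]. *)
Definition mesh_step (R : realType) (d : R) (m : nat) : R :=
  1 / (2 * d * (3 * m.+1)%:R).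

Lemma mesh_step_gt0 (R : realType) (d : R) (d0 : 0 < d) (m : nat) :
  0 < mesh_step d m.
Proof. by rewrite divr_gt0// !mulr_gt0// ltr0n. Qed.

Lemma cvg_mesh_step (R : realType) (d : R) (d0 : 0 < d) :
  mesh_step d m @[m --> \oo] --> (0 : R).
Proof.
rewrite -(mulr0 (1 / (6 * d))).
under eq_cvg => m.
  have -> : mesh_step d m = 1 / (6 * d) * harmonic m.
    have n0 : m.+1%:R != 0 :> R by rewrite pnatr_eq0.
    rewrite /mesh_step /= natrM; move: m.+1%:R n0 => n n0.
    by field; rewrite n0 gt_eqF.
  over.
by apply: cvgM; [exact: cvg_cst|exact: cvg_harmonic].
Qed.

Lemma cvg_total_rate (R : realType) (d : R) (d0 : 0 < d) :
  total_rate d (3 * m.+1) @[m --> \oo] --> 1 / d.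
Proof.
have y0 := cvg_mesh_step d0.
have bounds m : 1 / d * (1 + mesh_step d m)^-1 <= total_rate d (3 * m.+1) <=
   1 / d * (1 + mesh_step d m / 2).
  have yp := mesh_step_gt0 d0 m.
  have -> : total_rate d (3 * m.+1) =
      1 / d * (arsinh (mesh_step d m) / mesh_step d m).
    rewrite /total_rate /mesh_rate -/(mesh_step d m).
    have n0 : (3 * m.+1)%:R != 0 :> R by rewrite pnatr_eq0.
    have nE : (3 * m.+1)%:R = 1 / (2 * d * mesh_step d m).
      rewrite /mesh_step; move: (3 * m.+1)%:R n0 => n n0.
      by field; rewrite n0 gt_eqF.
    by rewrite nE; field; rewrite !gt_eqF.
  have /andP[l u] := arsinh_bounds yp.
  have d1 : 0 < 1 / d by rewrite divr_gt0.
  rewrite !ler_pM2l// ler_pdivlMr// ler_pdivrMr//.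
  rewrite mulrC l /=; apply: (le_trans u); nra.
apply: (squeeze_cvgr (nearW _ bounds)).
- rewrite [X in _ --> X](_ : 1 / d = 1 / d * (1 + 0)^-1); last first.
    by rewrite addr0 invr1 mulr1.
  apply: cvgM; first exact: cvg_cst.
  by apply: cvgV; [rewrite addr0 oner_neq0|apply: cvgD; [exact: cvg_cst|]].
- rewrite [X in _ --> X](_ : 1 / d = 1 / d * (1 + 0 / 2)); last first.
    by rewrite mul0r addr0 mulr1.
  apply: cvgM; first exact: cvg_cst.
  apply: cvgD; first exact: cvg_cst.
  by apply: cvgM; [|exact: cvg_cst].
Qed.

(** The limit of [n * self_gap d n]. *)
Definition scaled_gap_lim (R : realType) (d : R) : R :=
  (cosh (1 / d / 2) - cosh (1 / d / 6)) / (2 * d * sinh (1 / d / 2)).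

Lemma scaled_gap_lim_gt0 (R : realType) (d : R) (d0 : 0 < d) :
  0 < scaled_gap_lim d.
Proof.
have i0 : 0 < 1 / d by rewrite divr_gt0.
apply: divr_gt0; first by rewrite subr_gt0 cosh_third_lt.
by apply: mulr_gt0; [rewrite mulr_gt0|apply: sinh_gt0; rewrite divr_gt0].
Qed.

Lemma cvg_scaled_gap (R : realType) (d : R) (d0 : 0 < d) :
  self_gap d (3 * m.+1) * (3 * m.+1)%:R @[m --> \oo] --> scaled_gap_lim d.
Proof.
have s := cvg_total_rate d0.
have e m : self_gap d (3 * m.+1) * (3 * m.+1)%:R =
    (cosh (total_rate d (3 * m.+1) / 2) - cosh (total_rate d (3 * m.+1) / 6)) /
    (2 * d * Num.sqrt (1 + mesh_step d m ^+ 2) *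
     sinh (total_rate d (3 * m.+1) / 2)).
  rewrite /self_gap /green_norm sinh_mesh_rate// -/(mesh_step d m).
  have n0 : (3 * m.+1)%:R != 0 :> R by rewrite pnatr_eq0.
  have q0 : 0 < Num.sqrt (1 + mesh_step d m ^+ 2).
    by rewrite sqrtr_gt0; have := sqr_ge0 (mesh_step d m); lra.
  have s0 : 0 < sinh (total_rate d (3 * m.+1) / 2).
    by rewrite sinh_gt0// divr_gt0// total_rate_gt0.
  move: (3 * m.+1)%:R n0 => n n0.
  by field; rewrite n0 !gt_eqF.
under eq_cvg do rewrite e.
have half (a : R) : total_rate d (3 * m.+1) / a @[m --> \oo] --> 1 / d / a.
  by apply: cvgM; [exact: s|exact: cvg_cst].
have cc (a : R) : cosh (total_rate d (3 * m.+1) / a) @[m --> \oo] -->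
    cosh (1 / d / a).
  by apply: (continuous_cvg _ (h := @cosh R)); [exact: continuous_cosh|].
apply: cvgM; first by apply: cvgB; exact: cc.
apply: cvgV.
  have sp : 0 < sinh (1 / d / 2) by apply: sinh_gt0; rewrite !divr_gt0.
  by apply: lt0r_neq0; apply: mulr_gt0 => //; rewrite mulr_gt0.
apply: cvgM; last first.
  by apply: (continuous_cvg _ (h := @sinh R)); [exact: continuous_sinh|].
rewrite -[X in _ --> X]mulr1; apply: cvgM; first exact: cvg_cst.
rewrite -[X in _ --> X]sqrtr1.
apply: (continuous_cvg _ (h := @Num.sqrt R)); first exact: sqrt_continuous.
rewrite -[X in _ --> X]addr0; apply: cvgD; first exact: cvg_cst.
rewrite -[X in _ --> X](expr0n R 2).
by apply: (continuous_cvg _ (h := fun y : R => y ^+ 2));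
    [exact: exprn_continuous|exact: cvg_mesh_step].
Qed.

Lemma cvg_coupling (R : realType) (d : R) (d0 : 0 < d) :
  coupling d (3 * m.+1) @[m --> \oo] --> coupling_at (1 / d).
Proof.
apply: (continuous_cvg _ (h := @coupling_at R)); last exact: cvg_total_rate.
by apply: coupling_at_continuous; rewrite divr_gt0.
Qed.

Theorem mainTheorem5 (R : realType) (d : R) (d_gt0 : 0 < d)
    (hd : (1 + 2 * Num.sqrt 2) * cosh (1 / (6 * d)) <= cosh (1 / (2 * d))) :
  exists (V : 'I_3 -> R) (u v : forall m : nat, 'I_(3 * m.+1) -> R),
  [/\ (forall k, 0 < V k) /\ (exists k l, V k != V l),
      forall k, u m (spike_node m k) / (3 * m.+1)%:R @[m --> \oo] --> V k,
      three_spike_in_the_limit d u v,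
      (1 + 2 * Num.sqrt 2) * cosh (1 / (6 * d)) < cosh (1 / (2 * d)) ->
        \forall m \near \oo, three_spike_solution d (u m) (v m)
    & \forall m \near \oo, unstable d (u m) (v m)].
Proof.
pose r := coupling_at (1 / d).
have i0 : 0 < 1 / d by rewrite divr_gt0.
have r0 : 0 < r by rewrite coupling_at_gt0.
have r8 : 8 * r ^+ 2 <= 1 by rewrite (coupling_at_threshold d_gt0).1.
have G0 := scaled_gap_lim_gt0 d_gt0.
have rn := cvg_coupling d_gt0.
exists (fun k => profile r k / scaled_gap_lim d).
exists (@spike_u R d), (@spike_v R d).
split.
- split=> [k|]; first by rewrite divr_gt0// profile_gt0.
  exists 1, 0; rewrite lt_eqF// ltr_pM2r ?invr_gt0// /profile /=.
  have t0 := small_ratio_gt0 r0.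
  by rewrite ltr_pM2r ?small_ratio_lt1// invr_gt0; lra.
- move=> k; under eq_cvg => m.
    rewrite /spike_u sum_spike_node /height -mulrA -invfM.
    over.
  apply: cvgM.
    by apply: (continuous_cvg _ (h := fun x : R => profile x k));
      [exact: profile_continuous|exact: rn].
  by apply: cvgV; [rewrite gt_eqF|exact: cvg_scaled_gap].
- split.
    apply: nearW => m.
    by split; [exact: spike_shape_spike|exact: spike_v_equation].
  move=> k; under eq_cvg => m.
    have -> : spike_u d (spike_node m k) / spike_v d (spike_node m k) =
        profile (coupling d (3 * m.+1)) k / response (coupling d (3 * m.+1)) k.
      have g0 := self_gap_gt0 d_gt0 (isT : 0 < 3 * m.+1)%N.
      have q0 := response_gt0 k (coupling_gt0 d_gt0 (isT : 0 < 3 * m.+1)%N).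
      rewrite spike_v_node// /spike_u sum_spike_node /height.
      by field; rewrite !gt_eqF.
    over.
  have p0 := profile_gt0 k r0.
  rewrite -(divff (lt0r_neq0 p0)) -{2}(response_profile k r0 r8).
  apply: cvgM.
    by apply: (continuous_cvg _ (h := fun x : R => profile x k));
      [exact: profile_continuous|exact: rn].
  apply: cvgV; first by rewrite gt_eqF// response_gt0.
  by apply: (continuous_cvg _ (h := fun x : R => response x k));
      [exact: response_continuous|exact: rn].
- move=> hlt; have r8lt : 8 * r ^+ 2 < 1.
    by rewrite (coupling_at_threshold d_gt0).2.
  have : 8 * coupling d (3 * m.+1) ^+ 2 @[m --> \oo] --> 8 * r ^+ 2.
    apply: cvgM; first exact: cvg_cst.
    by apply: (continuous_cvg _ (h := fun y : R => y ^+ 2));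
      [exact: exprn_continuous|exact: rn].
  move=> /cvgr_lt/(_ _ r8lt); apply: filterS => m /ltW.
  exact: spike_solution.
- have c : contrast_rate (coupling d (3 * m.+1)) @[m --> \oo] -->
      contrast_rate r.
    apply: (continuous_cvg _ (h := @contrast_rate R)); last exact: rn.
    exact: contrast_rate_continuous.
  move: c => /cvgr_gt/(_ _ (contrast_rate_gt0 r0 r8)); apply: filterS => m.
  exact: spike_unstable.
Qed.
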